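(* Let $t \ge 1$ be an integer, let $(G,\sigma)$ be a signed $(2t+1)$-regular graph, and let $r$ be a real number. If $F_c((G,\sigma)) = r$, then $r = 2+\frac{1}{t}$ or $r \ge 2 + \frac{2}{2t-1}$.
   Context: Graphs are finite and may have parallel edges but no loops. A signed graph $(G,\sigma)$ is a graph $G$ with a function (signature) $\sigma: E(G)\to\{\pm1\}$. Each edge $e=uv$ is divided into two half-edges $h_e^u$ (incident with $u$) and $h_e^v$ (incident with $v$); $H(G)$ is the set of half-edges, $H(v)$ the set of half-edges incident with $v$, and $e_h$ the edge containing the half-edge $h$. An orientation of $(G,\sigma)$ is a function $\tau: H(G)\to\{\pm1\}$ with $\tau(h_e^u)\tau(h_e^v) = -\sigma(e)$ for each edge $e=uv$. Given an orientation $\tau$, the boundary of $f:E(G)\to\mathbb{R}$ is $\delta f(v)=\sum_{h\in H(v)}\tau(h)f(e_h)$. For real $r\ge 2$, $f$ is an $r$-flow on $(G,\sigma)$ if, for every edge $e$, $f(e)=0$ or $1\le |f(e)|\le r-1$, and $\delta f(v)=0$ for all $v\in V(G)$; it is nowhere-zero if $f(e)\ne 0$ for all $e$. $(G,\sigma)$ admits a nowhere-zero $r$-flow if one exists for some orientation. $F_c((G,\sigma))=\inf\{r : (G,\sigma)\text{ admits a nowhere-zero }r\text{-flow}\}$ (it is $\infty$ if there is no such $r$). *)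

(* Defs.v *)
From HB Require Import structures.
From mathcomp Require Import all_boot all_order all_algebra.
From mathcomp Require Import all_classical all_reals all_analysis.
Set Implicit Arguments.
Unset Strict Implicit.
Unset Printing Implicit Defensive.
Import Order.TTheory GRing.Theory Num.Theory.
Local Open Scope ring_scope.

(* Parallel edges are distinct elements of [edge] with the same [ends];
   loops are excluded by [card_ends]. *)
Record multigraph := Multigraph {
  vertex : finType;
  edge : finType;
  ends : edge -> {set vertex};
  card_ends : forall e : edge, #|ends e| = 2%N }.

Definition is_sign (x : int) : Prop := x = 1 \/ x = -1.

Record signed_graph := SignedGraph {
  graph_of :> multigraph;
  signature : edge graph_of -> int;
  signature_sign : forall e : edge graph_of, is_sign (signature e) }.

Section Graphs.
Variable G : multigraph.

(* As there are no loops, the half-edge of e at u is determined by (e, u). *)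
Definition half_edge : finType :=
  {h : edge G * vertex G | h.2 \in ends h.1}.

Definition edge_of (h : half_edge) : edge G := (val h).1.
Definition vertex_of (h : half_edge) : vertex G := (val h).2.

Definition half_edges_at (v : vertex G) : {set half_edge} :=
  [set h | vertex_of h == v].

Definition degree (v : vertex G) : nat := #|[set e : edge G | v \in ends e]|.

Definition regular (d : nat) : Prop := forall v : vertex G, degree v = d.

End Graphs.

Section Flows.
Variables (R : realType) (G : signed_graph).

Definition orientation (tau : half_edge G -> int) : Prop :=
  (forall h, is_sign (tau h)) /\
  (forall h k : half_edge G, h != k -> edge_of h = edge_of k ->
     tau h * tau k = - signature (edge_of h)).

Definition boundary (tau : half_edge G -> int) (f : edge G -> R)
    (v : vertex G) : R :=
  \sum_(h in half_edges_at v) (tau h)%:~R * f (edge_of h).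

Definition is_flow (tau : half_edge G -> int) (r : R) (f : edge G -> R) :
    Prop :=
  (forall e, f e = 0 \/ 1 <= `|f e| <= r - 1) /\
  (forall v, boundary tau f v = 0).

Definition nowhere_zero (f : edge G -> R) : Prop := forall e, f e != 0.

Definition admits_nowhere_zero_flow (r : R) : Prop :=
  exists tau f, [/\ orientation tau, is_flow tau r f & nowhere_zero f].

(* [ereal_inf set0 = +oo]. The bound 2 <= r matters only for edgeless graphs,
   where it gives the value 2. *)
Definition circular_flow_number : \bar R :=
  ereal_inf [set r%:E | r in [set r : R |
    2 <= r /\ admits_nowhere_zero_flow r]]%classic.

End Flows.

Arguments circular_flow_number R G : clear implicits.

(* Main.v *)
Require Import Defs.
From HB Require Import structures.
From mathcomp Require Import all_boot all_order all_algebra.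
From mathcomp Require Import all_classical all_reals all_analysis.
From mathcomp Require Import zify ring lra.
Set Implicit Arguments.
Unset Strict Implicit.
Unset Printing Implicit Defensive.
Import Order.TTheory GRing.Theory Num.Theory.
Local Open Scope ring_scope.

(** The theorem reduces to a statement about a single vertex. Let [f] be a
    nowhere-zero [r]-flow and put [M = r - 1]. The half-edges at a vertex carry
    [2t+1] signed values of absolute value between [1] and [M] whose sum is [0].
    One sign occurs at least [t+1] times and the other at most [t] times, so
    [t+1 <= tM], that is, [r >= 2 + 1/t] ([zero_sum_lower_bound]).

    Suppose now that [r < 2 + 2/(2t-1)], that is, [M (2t-1) < 2t+1]. Then the
    signs split exactly as [t+1] against [t], and the number
    [c = 2t/(2t-1)] separates the two sides: each value of the majority sign is
    smaller than [c] in absolute value, because the other [t] are at least [1]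
    and the total is at most [tM]; each value of the minority sign is at least
    [c], because the other [t-1] are at most [M] and the total is at least [t+1]
    ([majority_small], [minority_large]). Whether [|f e| < c] depends only on
    the edge [e], not on the end from which it is seen. Hence one may replace
    [|f e|] by [1] if [|f e| < c] and by [1 + 1/t] otherwise, and keep the sign
    of [f e]: at every vertex [t+1] values [1] balance [t] values [1 + 1/t], so
    the result is a nowhere-zero [(2 + 1/t)]-flow for the same orientation
    ([flow_rounding]). Therefore a circular flow number below [2 + 2/(2t-1)]
    equals [2 + 1/t]. *)

(** * Zero-sum families with entries bounded away from zero *)

Section ZeroSum.
Variables (R : realType) (T : finType).
Implicit Types (S : {set T}) (x : T -> R) (M : R) (t : nat).

Definition zero_sum_in S M x : Prop :=
  (forall i, i \in S -> 1 <= `|x i| <= M) /\ \sum_(i in S) x i = 0.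

Definition pos_part S x : {set T} := [set i in S | 0 < x i].
Definition neg_part S x : {set T} := [set i in S | x i < 0].

Lemma zero_sum_inN S M x :
  zero_sum_in S M x -> zero_sum_in S M (fun i => - x i).
Proof.
case=> xM x0; split=> [i iS|]; first by rewrite normrN xM.
by rewrite sumrN x0 oppr0.
Qed.

Lemma neg_partE S x : neg_part S x = pos_part S (fun i => - x i).
Proof. by apply/setP=> i; rewrite !inE oppr_gt0. Qed.

Lemma pos_partN S x : pos_part S x = neg_part S (fun i => - x i).
Proof. by apply/setP=> i; rewrite !inE oppr_lt0. Qed.

Lemma big_sign_split S M x (F : T -> R) : zero_sum_in S M x ->
  \sum_(i in S) F i = \sum_(i in pos_part S x) F i + \sum_(i in neg_part S x) F i.
Proof.
case=> xM _; rewrite (bigID (fun i => 0 < x i)) /=; congr (_ + _).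
  by apply: eq_bigl => i; rewrite inE.
apply: eq_bigl => i; rewrite inE; case iS: (i \in S) => //=.
rewrite -leNgt le_eqVlt; case: eqP => //= xi0.
by have := xM _ iS; rewrite xi0 normr0 ler10.
Qed.

Lemma card_sign_split S M x : zero_sum_in S M x ->
  (#|pos_part S x| + #|neg_part S x| = #|S|)%N.
Proof.
move=> /(big_sign_split (fun=> 1)); rewrite !sumr_const -natrD => /eqP.
by rewrite eqr_nat => /eqP.
Qed.

Lemma sign_parts_balance S M x : zero_sum_in S M x ->
  \sum_(i in pos_part S x) `|x i| = \sum_(i in neg_part S x) `|x i|.
Proof.
move=> h; have := big_sign_split x h; rewrite h.2 => /esym/eqP.
rewrite addr_eq0 -sumrN => /eqP e.
rewrite (eq_bigr x) ?[LHS]e; first by apply: eq_bigr => i; rewrite inE => /andP[_ /ltr0_norm].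
by move=> i; rewrite inE => /andP[_ /gtr0_norm].
Qed.

Lemma sum_norm_bounds S M x (A : {set T}) : A \subset S -> zero_sum_in S M x ->
  #|A|%:R <= \sum_(i in A) `|x i| <= #|A|%:R * M.
Proof.
move=> /fintype.subsetP AS [xM _]; apply/andP; split.
  by rewrite -sumr_const; apply: ler_sum => i /AS/xM/andP[].
by rewrite mulr_natl -sumr_const; apply: ler_sum => i /AS/xM/andP[].
Qed.

Lemma pos_part_sub S x : pos_part S x \subset S.
Proof. by apply/fintype.subsetP=> i; rewrite inE => /andP[]. Qed.

Lemma neg_part_sub S x : neg_part S x \subset S.
Proof. by apply/fintype.subsetP=> i; rewrite inE => /andP[]. Qed.

(** The positive entries have a total of at least their number and the negative
    ones a total of at most [M] times their number. *)
Lemma card_pos_le S M x : zero_sum_in S M x ->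
  #|pos_part S x|%:R <= #|neg_part S x|%:R * M.
Proof.
move=> h; have /andP[le1 _] := sum_norm_bounds (pos_part_sub S x) h.
apply: le_trans le1 _; rewrite (sign_parts_balance h).
by have /andP[] := sum_norm_bounds (neg_part_sub S x) h.
Qed.

(** Changing all signs exchanges the two parts, so the positive entries may be
    taken as the majority. *)
Lemma majority_wlog S M x t (Q : (T -> R) -> Prop) :
    #|S| = (2 * t + 1)%N -> zero_sum_in S M x ->
    (Q (fun i => - x i) -> Q x) ->
    (forall y, zero_sum_in S M y ->
       (#|neg_part S y| <= t < #|pos_part S y|)%N -> Q y) ->
  Q x.
Proof.
move=> cS h QN maj; have cs := card_sign_split h.
case: (leqP #|neg_part S x| t) => [le_nt | lt_tn].
  by apply: maj => //; lia.
apply: QN; apply: maj; first exact: zero_sum_inN.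
by rewrite -neg_partE -pos_partN; lia.
Qed.

(** At least [t+1] entries of absolute value at least [1] are balanced by at
    most [t] entries of absolute value at most [M]. *)
Lemma zero_sum_lower_bound S M x t :
    #|S| = (2 * t + 1)%N -> zero_sum_in S M x ->
  t.+1%:R <= t%:R * M.
Proof.
move=> cS h; apply: (majority_wlog (Q := fun=> _) cS h) => // y hy /andP[nt tp].
have M0 : 0 <= M.
  have [i iS] : exists i, i \in S by apply/card_gt0P; rewrite cS addn1.
  by have /andP[y1 yM] := hy.1 i iS; apply: le_trans yM.
apply: le_trans (_ : #|pos_part S y|%:R <= _); first by rewrite ler_nat.
by apply: le_trans (card_pos_le hy) _; rewrite ler_wpM2r // ler_nat.
Qed.

Section BelowGap.
Variables (S : {set T}) (M : R) (x : T -> R) (t : nat).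
Hypotheses (t_gt0 : (0 < t)%N) (cS : #|S| = (2 * t + 1)%N).
Hypothesis (M_lt : M * (2 * t%:R - 1) < 2 * t%:R + 1).
Hypothesis (x_zero : zero_sum_in S M x).
Hypothesis (x_maj : (#|neg_part S x| <= t < #|pos_part S x|)%N).

(** A more uneven split, [t+2] against [t-1] at best, would force
    [t+2 <= (t-1) M], while [(t-1) (2t+1)/(2t-1) < t+2]. *)
Lemma card_minority : #|neg_part S x| = t.
Proof.
have t1 : 1 <= t%:R :> R by rewrite ler1n.
have /andP[le_nt _] := x_maj; have cs := card_sign_split x_zero.
have := card_pos_le x_zero.
have /(congr1 (fun n => n%:R : R)) : (#|pos_part S x| = 2 * t + 1 - #|neg_part S x|)%N by lia.
rewrite natrB; last by lia.
rewrite natrD natrM => ->.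
move: le_nt; rewrite leq_eqVlt => /orP[/eqP //|].
rewrite -(ler_nat R) -natr1 => lt_nt le_pn; exfalso; move: lt_nt le_pn (ler0n R #|neg_part S x|).
move: (#|_|%:R) => n lt_nt le_pn n0.
have d0 : 0 <= 2 * t%:R - 1 :> R by lra.
have := ler_wpM2r d0 le_pn; have := ler_wpM2l n0 (ltW M_lt); nra.
Qed.

Lemma card_majority : #|pos_part S x| = t.+1.
Proof. by have := card_sign_split x_zero; rewrite card_minority cS; lia. Qed.

(** The other [t] majority entries use up at least [t] of a total of at most
    [tM], which leaves less than [t (2t+1)/(2t-1) - t = 2t/(2t-1)]. *)
Lemma majority_small i : i \in pos_part S x ->
  `|x i| < 2 * t%:R / (2 * t%:R - 1).
Proof.
move=> iP; have t1 : 1 <= t%:R :> R by rewrite ler1n.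
rewrite ltr_pdivlMr; last by lra.
have := sign_parts_balance x_zero; rewrite (big_setD1 i) //=.
have /andP[+ _] := sum_norm_bounds
  (fintype.subset_trans (finset.subsetDl _ [set i]) (pos_part_sub S x)) x_zero.
have /andP[_] := sum_norm_bounds (neg_part_sub S x) x_zero.
have := cardsD1 i (pos_part S x); rewrite iP card_majority add1n => -[<-].
rewrite card_minority => le_N le_P balance.
have le_x : `|x i| + t%:R <= t%:R * M by lra.
have d0 : 0 <= 2 * t%:R - 1 :> R by lra.
have t0 : 0 < t%:R :> R by lra.
have := ler_wpM2r d0 le_x; have : t%:R * (M * (2 * t%:R - 1)) < t%:R * (2 * t%:R + 1).
  by rewrite ltr_pM2l.
nra.
Qed.

(** The other [t-1] minority entries cover at most [(t-1) M] of a total of at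
    least [t+1], which leaves at least
    [t + 1 - (t-1) (2t+1)/(2t-1) = 2t/(2t-1)]. *)
Lemma minority_large i : i \in neg_part S x ->
  2 * t%:R / (2 * t%:R - 1) <= `|x i|.
Proof.
move=> iN; have t1 : 1 <= t%:R :> R by rewrite ler1n.
rewrite ler_pdivrMr; last by lra.
have := sign_parts_balance x_zero; rewrite [RHS](big_setD1 i) //=.
have /andP[_] := sum_norm_bounds
  (fintype.subset_trans (finset.subsetDl _ [set i]) (neg_part_sub S x)) x_zero.
have /andP[+ _] := sum_norm_bounds (pos_part_sub S x) x_zero.
have /(congr1 (fun n => n%:R : R)) := cardsD1 i (neg_part S x).
rewrite iN card_minority card_majority add1n -!natr1.
move: (#|_ :\ i|%:R) (ler0n R #|neg_part S x :\ i|) => k k0 tk le_P le_N balance.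
have le_x : k + 2 <= `|x i| + k * M by lra.
have d0 : 0 <= 2 * t%:R - 1 :> R by lra.
have := ler_wpM2r d0 le_x; have := ler_wpM2l k0 (ltW M_lt); nra.
Qed.

End BelowGap.

(** The values [1] and [1 + 1/t] are forced by [t+1] small entries having to
    balance [t] large ones. The choice between them depends on [|y|] alone, so
    the two ends of an edge agree on it. *)
Definition rounding t (y : R) : R :=
  Num.sg y * (if `|y| < 2 * t%:R / (2 * t%:R - 1) then 1 else 1 + t%:R^-1).

Lemma roundingN t y : rounding t (- y) = - rounding t y.
Proof. by rewrite /rounding sgrN normrN mulNr. Qed.

Lemma norm_rounding t y : y != 0 -> 1 <= `|rounding t y| <= 1 + t%:R^-1.
Proof.
move=> y0; have t0 : 0 <= t%:R^-1 :> R by rewrite invr_ge0.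
rewrite /rounding normrM normr_sg y0 mul1r.
by case: ifP => _; rewrite ger0_norm; lra.
Qed.

Lemma rounding_zero_sum S M x t :
    (0 < t)%N -> #|S| = (2 * t + 1)%N -> M * (2 * t%:R - 1) < 2 * t%:R + 1 ->
    zero_sum_in S M x ->
  \sum_(i in S) rounding t (x i) = 0.
Proof.
move=> t0 cS ltM h.
pose Q y := \sum_(i in S) rounding t (y i) = 0.
apply: (majority_wlog (Q := Q) cS h); rewrite /Q.
  by under eq_bigr do rewrite roundingN; rewrite sumrN => /eqP; rewrite oppr_eq0 => /eqP.
move=> y hy maj; rewrite (big_sign_split _ hy).
rewrite (eq_bigr (fun=> 1)) => [|i iP]; last first.
  rewrite /rounding (majority_small t0 cS ltM hy maj iP) mulr1.
  by move: iP; rewrite inE => /andP[_ /gtr0_sg].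
rewrite [X in _ + X](eq_bigr (fun=> - (1 + t%:R^-1))) => [|i iN]; last first.
  rewrite /rounding ltNge (minority_large t0 cS ltM hy maj iN) /=.
  by move: iN; rewrite inE => /andP[_ /ltr0_sg ->]; rewrite mulN1r.
rewrite !sumr_const (card_minority t0 cS ltM hy maj) (card_majority t0 cS ltM hy maj).
rewrite -[X in _ + X]mulr_natl -natr1; field.
by rewrite pnatr_eq0 -lt0n.
Qed.

End ZeroSum.

(** * Flows on regular signed graphs *)

Lemma card_half_edges_at (G : multigraph) (v : vertex G) :
  #|half_edges_at v| = degree v.
Proof.
rewrite /degree -(card_in_imset (f := @edge_of G) (D := half_edges_at v)).
  congr #|pred_of_set _|; apply/setP=> e; rewrite inE; apply/imsetP/idP.
    by case=> h; rewrite inE => /eqP <- ->; exact: (valP h).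
  by move=> ve; exists (exist _ (e, v) ve : half_edge G); rewrite ?inE.
move=> h k; rewrite !inE => /eqP hv /eqP kv hk; apply: val_inj.
rewrite (surjective_pairing (val h)) (surjective_pairing (val k)).
by congr (_, _); [exact: hk | exact: etrans hv (esym kv)].
Qed.

Section RegularFlows.
Variables (R : realType) (G : signed_graph) (t : nat).
Hypotheses (t_gt0 : (0 < t)%N) (hG : regular G (2 * t + 1)).
Implicit Types (tau : half_edge G -> int) (f : edge G -> R) (r : R).

Lemma flow_zero_sum tau r f (v : vertex G) :
    orientation tau -> is_flow tau r f -> nowhere_zero f ->
  zero_sum_in (half_edges_at v) (r - 1) (fun h => (tau h)%:~R * f (edge_of h)).
Proof.
move=> [sgn _] [fr f0] nz; split=> [h _|]; last exact: f0.
have -> : `|(tau h)%:~R * f (edge_of h)| = `|f (edge_of h)|.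
  by case: (sgn h) => ->; rewrite ?mulrN1z ?mulN1r ?normrN // mul1r.
by case: (fr (edge_of h)) => // fe; have := nz (edge_of h); rewrite fe eqxx.
Qed.

Lemma flow_lower_bound r : (0 < #|vertex G|)%N ->
  admits_nowhere_zero_flow G r -> 2 + 1 / t%:R <= r.
Proof.
move=> /card_gt0P[v _] [tau [f [otau ff nz]]].
have cS : #|half_edges_at v| = (2 * t + 1)%N by rewrite card_half_edges_at hG.
have := zero_sum_lower_bound cS (flow_zero_sum v otau ff nz).
have t0 : 0 < t%:R :> R by rewrite ltr0n.
rewrite -natr1 => le; suff : 1 / t%:R <= r - 2 by lra.
by rewrite ler_pdivrMr //; lra.
Qed.

(** The rounding is odd, so it commutes with the signs [tau h] and preserves
    each vertex condition separately. *)
Lemma flow_rounding r : r < 2 + 2 / (2 * t%:R - 1) ->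
  admits_nowhere_zero_flow G r -> admits_nowhere_zero_flow G (2 + 1 / t%:R : R).
Proof.
move=> ltr [tau [f [otau ff nz]]].
have t1 : 1 <= t%:R :> R by rewrite ler1n.
exists tau, (fun e => rounding t (f e)); split=> //; last first.
  move=> e; have /andP[+ _] := norm_rounding t (nz e).
  by rewrite -normr_gt0; apply: lt_le_trans.
split=> [e|v]; first by right; have := norm_rounding t (nz e); lra.
have cS : #|half_edges_at v| = (2 * t + 1)%N by rewrite card_half_edges_at hG.
have ltM : (r - 1) * (2 * t%:R - 1) < 2 * t%:R + 1.
  have : r - 2 < 2 / (2 * t%:R - 1) by lra.
  by rewrite ltr_pdivlMr; lra.
rewrite -[RHS](rounding_zero_sum t_gt0 cS ltM (flow_zero_sum v otau ff nz)).
apply: eq_bigr => h _; case: (otau.1 h) => ->; first by rewrite !mul1r.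
by rewrite mulrN1z !mulN1r roundingN.
Qed.

End RegularFlows.

Theorem theorem4p1 (R : realType) (t : nat) (ht : (1 <= t)%N)
  (G : signed_graph) (hV : (0 < #|vertex G|)%N) (hG : regular G (2 * t + 1))
  (r : R) (hr : circular_flow_number R G = r%:E) :
  r = 2 + 1 / t%:R \/ r >= 2 + 2 / (2 * t%:R - 1).
Proof.
have [le|lt] := leP (2 + 2 / (2 * t%:R - 1)) r; first by right.
left; apply/eqP; rewrite eq_le; apply/andP; split; rewrite -lee_fin -hr; last first.
  by apply: le_ereal_inf_tmp => _ [s [_ fs] <-]; rewrite lee_fin (flow_lower_bound ht hG).
have [_ [s [_ fs] <-]] : exists2 y, [set s%:E | s in [set s : R |
    2 <= s /\ admits_nowhere_zero_flow G s]]%classic y &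
    (y < (2 + 2 / (2 * t%:R - 1))%:E)%E.
  by apply: ereal_inf_lt; rewrite -/(circular_flow_number R G) hr lte_fin.
rewrite lte_fin => lts; apply: ereal_inf_lbound; exists (2 + 1 / t%:R) => //.
split; last exact: (flow_rounding ht hG lts fs).
by rewrite lerDl divr_ge0.
Qed.
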